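(* Let $\Omega$ be a nonempty open convex set in $S^n\subset\mathbb{R}^{n+1}$ contained in the upper hemisphere $\{x\in\mathbb{R}^{n+1}: \|x\|_e^2=1,\ x_{n+1}>0\}$, and let $H$ be the spherical Hilbert metric of $\Omega$. Let $\tilde\Omega$ be the image of $\Omega$ under the projection $P$ from the origin onto the hyperplane $\{x_{n+1}=1\}$, namely $P(x)=x/x_{n+1}$; it is an open convex set in this hyperplane, and let $\tilde H$ be its Euclidean Hilbert metric. Then $P:(\Omega,H)\to(\tilde\Omega,\tilde H)$ is an isometry.
   Context: $\|x\|_e^2=x_1^2+\cdots+x_{n+1}^2$, and $S^n$ is the unit sphere with angular distance $d$. A subset of $S^n$ is convex if it is contained in an open hemisphere and every pair of its points can be connected by a geodesic contained in it. For distinct $x,y\in\Omega$, $b(x,y)$ is the first intersection point of $\partial\Omega$ (boundary in $S^n$) with the geodesic ray from $x$ through $y$. The spherical Hilbert metric is $$H(x,y)=\frac12\log\left(\frac{\sin d(x,b(x,y))}{\sin d(y,b(x,y))}\cdot\frac{\sin d(y,b(y,x))}{\sin d(x,b(y,x))}\right)$$ for $x\ne y$, and $H(x,x)=0$. The Euclidean Hilbert metric of an open convex set $\tilde\Omega$ of the Euclidean space $\{x_{n+1}=1\}\cong\mathbb{R}^n$ is $\tilde H(u,v)=\frac12\big(\tilde F(u,v)+\tilde F(v,u)\big)$, where $\tilde F$ is the Euclidean Funk metric: $\tilde F(u,v)=\log\frac{|u-b(u,v)|}{|v-b(u,v)|}$ if $u\neq v$ and the Euclidean ray from $u$ through $v$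 meets $\partial\tilde\Omega$ at a point $b(u,v)$, and $\tilde F(u,v)=0$ otherwise. An isometry is a distance-preserving bijection. *)

(* Defs.v *)
From HB Require Import structures.
From mathcomp Require Import all_boot all_order all_algebra.
From mathcomp Require Import all_classical all_reals all_analysis.
Import Order.TTheory GRing.Theory Num.Theory.
Import numFieldNormedType.Exports.

Set Implicit Arguments.
Unset Strict Implicit.
Unset Printing Implicit Defensive.

Local Open Scope classical_set_scope.
Local Open Scope ring_scope.

Definition open_in (T : topologicalType) (M A : set T) : Prop :=
  A `<=` M /\ @open (subspace M) A.

(* Boundary of A relative to the ambient subset M, for the topology that M
   inherits from T. Points outside M are isolated in [subspace M], so that the
   result is contained in M. *)
Definition boundary_in (T : topologicalType) (M A : set T) : set T :=
  @closure (subspace M) A `\` @interior (subspace M) A.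

Definition isometry_on (R : realType) (T U : Type)
    (A : set T) (dA : T -> T -> R) (B : set U) (dB : U -> U -> R)
    (f : T -> U) : Prop :=
  set_bij A B f /\
  (forall x y, A x -> A y -> dB (f x) (f y) = dA x y).

Section Euclidean_structure.
Variables (R : realType) (n : nat).
Implicit Types x y : 'rV[R]_n.+1.

Definition dotv x y : R := \sum_(i < n.+1) x ord0 i * y ord0 i.

(* The library norm on row vectors is the max norm. *)
Definition enorm x : R := Num.sqrt (dotv x x).

Definition usphere : set 'rV[R]_n.+1 := [set x | enorm x = 1].

Definition upper_hemisphere : set 'rV[R]_n.+1 :=
  usphere `&` [set x | 0 < x ord0 ord_max].

(* The hyperplane x_{n+1} = 1. *)
Definition hyperplane1 : set 'rV[R]_n.+1 := [set x | x ord0 ord_max = 1].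

Definition central_proj x : 'rV[R]_n.+1 := (x ord0 ord_max)^-1 *: x.

End Euclidean_structure.

Section Spherical_geometry.
Variables (R : realType) (n : nat).
Implicit Types (x y v b : 'rV[R]_n.+1) (A : set 'rV[R]_n.+1).

Definition sph_dist x y : R := acos (dotv x y).

Definition unit_tangent x v : Prop := usphere v /\ dotv x v = 0.

(* The unit-speed great circle issued from x with initial velocity v. *)
Definition geod x v (t : R) : 'rV[R]_n.+1 := cos t *: x + sin t *: v.

Definition in_open_hemisphere A : Prop :=
  exists2 a : 'rV[R]_n.+1, usphere a & forall x, A x -> 0 < dotv a x.

Definition geod_connected A x y : Prop :=
  exists v (L : R), [/\ unit_tangent x v, 0 <= L, geod x v L = y &
    forall t : R, 0 <= t <= L -> A (geod x v t)].

Definition sph_convex A : Prop :=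
  [/\ A `<=` @usphere R n, in_open_hemisphere A &
      forall x y, A x -> A y -> x <> y -> geod_connected A x y].

(* v is the initial velocity at x of the geodesic ray from x through y, where
   the ray starts along the arc of length < pi joining x to y. *)
Definition sph_ray_dir x y v : Prop :=
  unit_tangent x v /\ (exists2 s : R, 0 < s < pi & geod x v s = y).

Definition sph_first_hit A x y : set 'rV[R]_n.+1 :=
  [set b | exists v (t : R),
    [/\ sph_ray_dir x y v, 0 <= t, geod x v t = b,
        boundary_in (@usphere R n) A b &
        forall s : R, 0 <= s < t -> ~ boundary_in (@usphere R n) A (geod x v s)]].

Definition sph_b A x y : 'rV[R]_n.+1 := xget 0 (sph_first_hit A x y).

Definition sph_hilbert A x y : R :=
  if x == y then 0 else
  2^-1 * ln ((sin (sph_dist x (sph_b A x y)) / sin (sph_dist y (sph_b A x y)))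
           * (sin (sph_dist y (sph_b A y x)) / sin (sph_dist x (sph_b A y x)))).

End Spherical_geometry.

(* Euclidean geometry of the hyperplane x_{n+1} = 1, with its induced norm. *)
Section Euclidean_Hilbert.
Variables (R : realType) (n : nat).
Implicit Types (u v : 'rV[R]_n.+1) (A : set 'rV[R]_n.+1).

Definition euc_ray u v : set 'rV[R]_n.+1 :=
  [set p | exists2 t : R, 0 <= t & p = u + t *: (v - u)].

(* For A open and convex in the hyperplane and distinct u, v in A this set has
   at most one point. *)
Definition euc_hit A u v : set 'rV[R]_n.+1 :=
  euc_ray u v `&` boundary_in (@hyperplane1 R n) A.

Definition euc_b A u v : 'rV[R]_n.+1 := xget 0 (euc_hit A u v).

Definition euc_funk A u v : R :=
  if `[< u <> v /\ euc_hit A u v !=set0 >]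
  then ln (enorm (u - euc_b A u v) / enorm (v - euc_b A u v))
  else 0.

Definition euc_hilbert A u v : R := 2^-1 * (euc_funk A u v + euc_funk A v u).

End Euclidean_Hilbert.

(* Main.v *)
Require Import Defs.
From mathcomp Require Import all_boot all_order all_algebra.
From mathcomp Require Import all_classical all_reals all_analysis.
From mathcomp Require Import ring lra.
Import Order.TTheory GRing.Theory Num.Theory.
Import numFieldNormedType.Exports.
Local Open Scope classical_set_scope.
Local Open Scope ring_scope.

(** Both domains are slices of one open convex cone: if C is the set of positive
multiples of points of Omega, then Omega is the trace of C on the sphere and its
central projection is the trace of C on the hyperplane. Both level sets have the
form N = 1 with N continuous, positively homogeneous and positive on C, and on
such a slice the relative boundary is the trace of closure C \ C
([boundary_in_slice]). So the two metrics see the same boundary of C.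

Inside the plane spanned by x and y, the spherical ray from x through y leaves C
at a point b with s b = a y - c x, where s, a, c > 0, and the ratio of sines
sin d(x, b) / sin d(y, b) is a / c ([sph_b_spec]). Let u and v be the projections
of x and y. Then a y - c x = A v - B u, where A and B are a and c multiplied by
the last coordinates of y and x. If A > B, the ray from u through v meets the
boundary at (A v - B u) / (A - B), and the ratio of distances there is A / B. If
A = B, then b lies on the equator, the Euclidean ray stays in the domain, and the
Funk distance is 0 = ln (A / B). In both cases the Funk distance is the logarithm
of a / c times the quotient of the last coordinates of y and x ([euc_funkE]).
Exchanging x and y inverts this quotient, so it disappears from the symmetrized
metric.

Convexity enters through the inclusion C + closure C `<=` C ([coneD_closure]),
which shows that the directions a v - c u on the boundary of C all have the same
ratio a / c ([exit_ratio]). This makes the Euclidean hitting point unique, and it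
excludes such a point when A = B. *)

(** * Slices of an open convex cone *)

Section OpenConvexCone.
Context {R : realType} {V : normedModType R}.
Variable C : set V.
Hypothesis openC : open C.
Hypothesis coneZ : forall (a : R) z, 0 < a -> C z -> C (a *: z).
Hypothesis coneD : forall z w, C z -> C w -> C (z + w).

(** A point w' of C close to w leaves a remainder z + w - w' close to z, hence
in C. *)
Lemma coneD_closure z w : C z -> closure C w -> C (z + w).
Proof.
move=> Cz clw.
have nCw : nbhs w [set w' | C (z + w - w')].
  have cf : {for w, continuous (fun w' : V => z + w - w')}.
    by apply: cvgB; [exact: cvg_cst|exact: cvg_id].
  apply: cf; apply: open_nbhs_nbhs; split; first exact: openC.
  by rewrite /= addrK.
have [w' [Cw' /= Cd]] := clw _ nCw.
by rewrite -(subrK w' (z + w)); exact: coneD.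
Qed.

Lemma closure_coneZ a w : 0 < a -> closure C w -> closure C (a *: w).
Proof.
move=> a0 clw B nB.
have cf : {for w, continuous (fun w' : V => a *: w')}.
  by apply: cvgZ; [exact: cvg_cst|exact: cvg_id].
have [w' [Cw' /= Bw']] := clw _ (cf _ nB).
by exists (a *: w'); split => //; exact: coneZ.
Qed.

(** Where a planar ray starting in C leaves C is determined by its direction: if
a / c were smaller than a' / c', then a' v - c' u would be, up to scaling, the sum
of a multiple of v and of a point of closure C, hence a point of C. *)
Lemma exit_ratio u v (a c a' c' : R) : C v ->
  0 < c -> 0 < c' ->
  closure C (a *: v - c *: u) -> ~ C (a *: v - c *: u) ->
  closure C (a' *: v - c' *: u) -> ~ C (a' *: v - c' *: u) ->
  a * c' = a' * c.
Proof.
move=> Cv.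
have le_ratio b d b' d' : 0 < d -> 0 < d' -> closure C (b *: v - d *: u) ->
    ~ C (b' *: v - d' *: u) -> b' * d <= b * d'.
  move=> d0 d'0 cl nC; rewrite leNgt; apply/negP => lt; apply: nC.
  rewrite -(scalerK (lt0r_neq0 d0) (_ - _)); apply: coneZ; first by rewrite invr_gt0.
  have -> : d *: (b' *: v - d' *: u) =
      (b' * d - b * d') *: v + d' *: (b *: v - d *: u).
    rewrite !scalerBr !scalerA scalerBl addrA (mulrC d' b) subrK.
    by rewrite (mulrC d b') (mulrC d d').
  apply: coneD_closure; first by apply: coneZ => //; rewrite subr_gt0.
  exact: closure_coneZ.
move=> c0 c'0 cl nC cl' nC'; apply/eqP; rewrite eq_le.
by rewrite (le_ratio a' c' a c)// (le_ratio a c a' c').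
Qed.

Variable N : V -> R.
Hypothesis contN : continuous N.
Hypothesis NZ : forall (a : R) z, 0 < a -> N (a *: z) = a * N z.
Hypothesis N_gt0 : forall z, C z -> 0 < N z.

Let level1 : set V := [set z | N z = 1].

Lemma open_in_slice : open_in level1 (C `&` level1).
Proof.
split; first by move=> z [].
by apply/open_subspaceP; exists C => //; rewrite -setIA setIid.
Qed.

Lemma normalize_continuous z : N z != 0 ->
  {for z, continuous (fun w => (N w)^-1 *: w)}.
Proof.
by move=> Nz0; apply: cvgZ; [apply: cvgV => //; exact: contN|exact: cvg_id].
Qed.

(** The normalization z |-> z / N z is continuous on the level set, fixes it, and
sends C into the slice, so it moves approximating points of C into the slice. *)
Lemma closure_slice z : level1 z -> closure (C `&` level1) z <-> closure C z.
Proof.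
move=> Nz1; split=> [|clz B nB]; first by apply: closureS => w [].
have nB' : nbhs z [set w | B ((N w)^-1 *: w)].
  apply: (@normalize_continuous z); first by rewrite Nz1 oner_neq0.
  by rewrite Nz1 invr1 scale1r.
have [w [Cw /= Bw]] := clz _ nB'.
have Nw0 := N_gt0 _ Cw.
have iNw0 : 0 < (N w)^-1 by rewrite invr_gt0.
exists ((N w)^-1 *: w); split => //; split; first exact: coneZ.
by rewrite /level1 /= NZ// mulVf// gt_eqF.
Qed.

Lemma boundary_in_slice z : boundary_in level1 (C `&` level1) z <->
  [/\ level1 z, closure C z & ~ C z].
Proof.
have [_ oS] := open_in_slice.
rewrite /boundary_in ((interior_id _).1 oS) closure_subspaceW; last by move=> ? [].
split.
  move=> [[clz lz] nz]; split => //; first by apply/(closure_slice _ lz).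
  by move=> Cz; apply: nz.
by move=> [lz clz nz]; split; [split => //; apply/(closure_slice _ lz)|case].
Qed.

End OpenConvexCone.

(** * Euclidean structure and great circles *)

Section EuclideanStructure.
Context {R : realType} {n : nat}.
Implicit Types x y z : 'rV[R]_n.+1.

Lemma dotvC x y : dotv x y = dotv y x.
Proof. by apply: eq_bigr => i _; rewrite mulrC. Qed.

Lemma dotvDl x y z : dotv (x + y) z = dotv x z + dotv y z.
Proof. by rewrite -big_split; apply: eq_bigr => i _; rewrite !mxE mulrDl. Qed.

Lemma dotvZl (a : R) x z : dotv (a *: x) z = a * dotv x z.
Proof. by rewrite mulr_sumr; apply: eq_bigr => i _; rewrite !mxE mulrA. Qed.

Lemma dotvDr x y z : dotv z (x + y) = dotv z x + dotv z y.
Proof. by rewrite dotvC dotvDl !(dotvC z). Qed.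

Lemma dotvZr (a : R) x z : dotv z (a *: x) = a * dotv z x.
Proof. by rewrite dotvC dotvZl dotvC. Qed.

Lemma dotv_usphere x : usphere x -> dotv x x = 1.
Proof.
rewrite /usphere /= /enorm => x1.
have : 0 <= dotv x x by apply: sumr_ge0 => i _; rewrite -expr2 sqr_ge0.
by move/sqr_sqrtr => <-; rewrite x1 expr1n.
Qed.

Lemma enormZ (a : R) x : enorm (a *: x) = `|a| * enorm x.
Proof.
rewrite /enorm dotvZl dotvZr mulrA -expr2 sqrtrM ?sqr_ge0//.
by rewrite sqrtr_sqr.
Qed.

Lemma enorm_eq0 x : enorm x = 0 -> x = 0.
Proof.
move=> /eqP; rewrite sqrtr_eq0 => dx; apply/rowP => i; rewrite mxE.
have ge0 (j : 'I_n.+1) : true -> 0 <= x ord0 j * x ord0 j.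
  by rewrite -expr2 sqr_ge0.
have : dotv x x == 0 by rewrite eq_le dx sumr_ge0.
rewrite psumr_eq0// => /allP /(_ i (mem_index_enum _)) /=.
by rewrite mulf_eq0 orbb => /eqP.
Qed.

Lemma coord0_continuous i : continuous (fun x : 'rV[R]_n.+1 => x ord0 i).
Proof. exact: coord_continuous. Qed.

Lemma dotv_continuous : continuous (fun x => dotv x x).
Proof.
apply: continuous_big => [|i _ x]; first exact: add_continuous.
by apply: (@cvgM _ _ (nbhs x)); exact: coord0_continuous.
Qed.

Lemma enorm_continuous : continuous (@enorm R n).
Proof.
move=> x; apply: continuous_comp; first exact: dotv_continuous.
exact: sqrt_continuous.
Qed.

Lemma geod_continuous x v : continuous (geod x v).
Proof.
move=> t; apply: cvgD; apply: cvgZ; try exact: cvg_cst.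
  exact: continuous_cos.
exact: continuous_sin.
Qed.

Lemma dotv_geod x v s t : usphere x -> unit_tangent x v ->
  dotv (geod x v s) (geod x v t) = cos (t - s).
Proof.
move=> x1 [v1 xv]; rewrite cosB /geod !(dotvDl, dotvDr, dotvZl, dotvZr).
by rewrite (dotvC v x) xv !dotv_usphere//; ring.
Qed.

Lemma geod0 x v : geod x v 0 = x.
Proof. by rewrite /geod cos0 sin0 scale1r scale0r addr0. Qed.

Lemma geodpi x v : geod x v pi = - x.
Proof. by rewrite /geod cospi sinpi scaleN1r scale0r addr0. Qed.

(** For s = d(x, y) this writes the geodesic from x through y as a combination of
x and y. The coefficient of x changes sign when the geodesic passes y. *)
Lemma geod_interpol x v s t :
  sin s *: geod x v t = sin (s - t) *: x + sin t *: geod x v s.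
Proof.
rewrite /geod sinB !scalerDr !scalerA addrA -scalerDl; congr (_ *: _ + _ *: _); ring.
Qed.

Lemma sin_sph_dist_geod x v s t : usphere x -> unit_tangent x v ->
  s <= t <= s + pi -> sin (sph_dist (geod x v s) (geod x v t)) = sin (t - s).
Proof.
move=> x1 xv /andP[st ts]; rewrite /sph_dist dotv_geod// cosK//.
by rewrite in_itv/=; apply/andP; split; lra.
Qed.

End EuclideanStructure.

(** * The cone over a spherical convex set *)

Definition cone_over {R : realType} {n : nat} (A : set 'rV[R]_n.+1) : set 'rV[R]_n.+1 :=
  [set z | exists2 a : R, 0 < a & A (a *: z)].

Section ConeOver.
Context {R : realType} {n : nat}.
Variable Omega : set 'rV[R]_n.+1.
Hypothesis upper : Omega `<=` @upper_hemisphere R n.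
Hypothesis openO : open_in (@usphere R n) Omega.
Hypothesis convO : sph_convex Omega.

Local Notation C := (cone_over Omega).
Local Notation last z := (z ord0 ord_max).

Lemma subset_cone_over x : Omega x -> C x.
Proof. by move=> Ox; exists 1; rewrite ?scale1r. Qed.

Lemma cone_overZ a z : 0 < a -> C z -> C (a *: z).
Proof.
move=> a0 [b b0 Oz]; exists (b / a); first exact: divr_gt0.
by rewrite scalerA divfK ?gt_eqF.
Qed.

Lemma cone_over_last_gt0 z : C z -> 0 < last z.
Proof.
move=> [a a0 /upper[_]] /=; by rewrite mxE pmulr_rgt0.
Qed.

Lemma cone_over_enorm_gt0 z : C z -> 0 < enorm z.
Proof.
move=> [a a0 /upper[]]; rewrite /usphere /= enormZ gtr0_norm// => az _.
by rewrite -(pmulr_rgt0 _ a0) az.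
Qed.

Lemma lastZ (a : R) (z : 'rV[R]_n.+1) : last (a *: z) = a * last z.
Proof. by rewrite mxE. Qed.

Lemma cone_over_usphere : C `&` @usphere R n = Omega.
Proof.
apply/seteqP; split => [z [[a a0 Oz] z1]|z Oz]; last first.
  by split; [exact: subset_cone_over|case: (upper _ Oz)].
have [az1 _] := upper _ Oz; move: az1 z1 Oz.
rewrite /usphere /= enormZ gtr0_norm// => + z1; rewrite z1 mulr1 => ->.
by rewrite scale1r.
Qed.

Lemma cone_over_hyperplane1 : C `&` @hyperplane1 R n = @central_proj R n @` Omega.
Proof.
apply/seteqP; split => [z [[a a0 Oz] z1]|_ [x Ox <-]].
  exists (a *: z) => //; rewrite /central_proj lastZ z1 mulr1 scalerA mulVf ?scale1r//.
  by rewrite gt_eqF.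
have [_ /= xl] := upper _ Ox; split.
  by apply: cone_overZ; [rewrite invr_gt0|exact: subset_cone_over].
by rewrite /hyperplane1 /= lastZ mulVf// gt_eqF.
Qed.

Lemma open_cone_over : open C.
Proof.
case: openO => _ /open_subspaceP[U oU US].
have UO z : U z -> usphere z -> Omega z.
  by move=> Uz Sz; suff [] : (Omega `&` @usphere R n) z by []; rewrite -US.
rewrite openE => z Cz; have Nz := cone_over_enorm_gt0 _ Cz.
have iNz : 0 < (enorm z)^-1 by rewrite invr_gt0.
have Sz w : 0 < enorm w -> usphere ((enorm w)^-1 *: w).
  move=> w0; rewrite /usphere /= enormZ gtr0_norm ?invr_gt0// mulVf//.
  by rewrite gt_eqF.
have nU : nbhs z [set w | U ((enorm w)^-1 *: w)].
  apply: (@normalize_continuous _ _ (@enorm R n)) => //.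
  - exact: enorm_continuous.
  - by rewrite gt_eqF.
  - apply: open_nbhs_nbhs; split => //.
    suff [] : (U `&` @usphere R n) ((enorm z)^-1 *: z) by [].
    rewrite US; split; last exact: Sz.
    rewrite -cone_over_usphere; split; last exact: Sz.
    exact: cone_overZ.
have nN : nbhs z [set w | 0 < enorm w].
  by have /(_ _ (lt_nbhsr Nz)) := @enorm_continuous R n z.
apply: filterS2 nU nN => w /= Uw w0.
exists (enorm w)^-1; first by rewrite invr_gt0.
by apply: UO => //; exact: Sz.
Qed.

(** Any geodesic of the convexity hypothesis is shorter than pi, because it would
otherwise pass through - x, which is not in the upper hemisphere. *)
Lemma geod_arc x y : Omega x -> Omega y -> x <> y ->
  exists v s, [/\ unit_tangent x v, 0 < s < pi, geod x v s = y &
    forall t : R, 0 <= t <= s -> Omega (geod x v t)].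
Proof.
move=> Ox Oy xy; have [_ _ /(_ _ _ Ox Oy xy)[v [L [xv L0 xL OL]]]] := convO.
exists v, L; split => //; apply/andP; split.
  rewrite lt_neqAle L0 andbT eq_sym; apply/eqP => L00.
  by apply: xy; rewrite -xL L00 geod0.
rewrite ltNge; apply/negP => piL.
have piL' : (0 : R) <= pi <= L by rewrite pi_ge0.
have := OL _ piL'; rewrite geodpi => /upper[_] /=; rewrite mxE.
by have [_ /=] := upper _ Ox; lra.
Qed.

(** By [geod_interpol], the direction of geod x v t runs continuously from x to y
as t goes from 0 to s; the intermediate value theorem finds the t at which it is
the direction of a x + b y. *)
Lemma cone_over_comb x y a b : Omega x -> Omega y -> 0 < a -> 0 < b ->
  C (a *: x + b *: y).
Proof.
move=> Ox Oy a0 b0; have [->|/eqP xy] := eqVneq x y.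
  by rewrite -scalerDl; apply: cone_overZ; [lra|exact: subset_cone_over].
have [v [s [xv sp ys Os]]] := geod_arc _ _ Ox Oy xy.
have sins := sin_gt0_pi sp; have /andP[s0 spi] := sp.
(* f vanishes when sin (s - t) and sin t are in the proportion of a and b. *)
pose f t : R := a * sin t - b * sin (s - t).
have f0 : f 0 = - (b * sin s) by rewrite /f sin0 mulr0 subr0 sub0r.
have fs : f s = a * sin s by rewrite /f subrr sin0 mulr0 subr0.
have cf : continuous f.
  move=> t; apply: cvgB; apply: cvgM; try exact: cvg_cst.
    exact: continuous_sin.
  apply: (@continuous_comp _ _ _ (fun t => s - t) sin); last exact: continuous_sin.
  by apply: cvgB; [exact: cvg_cst|exact: cvg_id].
have bs : 0 < b * sin s by rewrite mulr_gt0.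
have as_ : 0 < a * sin s by rewrite mulr_gt0.
have [||| t] := @IVT R f 0 s 0.
- exact: ltW.
- exact: continuous_subspaceT.
- by rewrite f0 fs ge_min le_max; lra.
rewrite in_itv /= => /andP[t0 ts] ft.
have ts' : t < s.
  by rewrite lt_neqAle ts andbT; apply/eqP => tE; move: ft; rewrite tE fs; lra.
have sst : 0 < sin (s - t) by apply: sin_gt0_pi; lra.
suff -> : a *: x + b *: y = (a * sin s / sin (s - t)) *: geod x v t.
  apply: cone_overZ; first by rewrite divr_gt0.
  by apply: subset_cone_over; apply: Os; rewrite t0.
rewrite mulrAC -scalerA geod_interpol ys scalerDr !scalerA; congr (_ *: _ + _ *: _).
  by rewrite divfK// gt_eqF.
have -> : a / sin (s - t) * sin t = (a * sin t) / sin (s - t) by rewrite mulrAC.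
by move/subr0_eq : ft => ->; rewrite mulfK// gt_eqF.
Qed.

Lemma cone_overD z w : C z -> C w -> C (z + w).
Proof.
move=> [a a0 Oz] [b b0 Ow].
have := cone_over_comb _ _ a^-1 b^-1 Oz Ow.
rewrite !scalerA !mulVf ?gt_eqF// !scale1r; by apply; rewrite invr_gt0.
Qed.

Lemma closure_cone_over_last_ge0 z : closure C z -> 0 <= last z.
Proof.
move=> clz.
have cl : closed [set w : 'rV[R]_n.+1 | 0 <= last w].
  apply: (@closed_comp _ _ (fun w : 'rV[R]_n.+1 => last w) [set r | 0 <= r]).
    by move=> w _; exact: coord0_continuous.
  exact: closed_ge.
apply: cl; apply: closureS clz => w Cw; exact: ltW (cone_over_last_gt0 _ Cw).
Qed.

Lemma boundary_usphere z : boundary_in (@usphere R n) Omega z <->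
  [/\ usphere z, closure C z & ~ C z].
Proof.
rewrite -{1}cone_over_usphere; apply: (@boundary_in_slice _ _ C open_cone_over cone_overZ (@enorm R n)).
- exact: enorm_continuous.
- by move=> a w a0; rewrite enormZ gtr0_norm.
- exact: cone_over_enorm_gt0.
Qed.

Lemma boundary_hyperplane1 z :
  boundary_in (@hyperplane1 R n) (@central_proj R n @` Omega) z <->
  [/\ hyperplane1 z, closure C z & ~ C z].
Proof.
rewrite -cone_over_hyperplane1.
apply: (@boundary_in_slice _ _ C open_cone_over cone_overZ (fun w => last w)).
- exact: coord0_continuous.
- by move=> a w a0; exact: lastZ.
- exact: cone_over_last_gt0.
Qed.

(** The exit time is the infimum of the times at which the geodesic is outside C.
It is attained since C is open, and it is less than pi since - x is not even in
the closure of C. *)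
Lemma first_exit x v : Omega x ->
  exists2 t : R, 0 <= t < pi & [/\ closure C (geod x v t), ~ C (geod x v t) &
    forall r, 0 <= r < t -> C (geod x v r)].
Proof.
move=> Ox; have [_ /= xl] := upper _ Ox.
pose T : set R := [set t | 0 <= t /\ ~ C (geod x v t)].
have T0 t : T t -> 0 <= t by case.
have Tpi : T pi.
  split; first exact: pi_ge0.
  by rewrite geodpi => /cone_over_last_gt0; rewrite mxE; lra.
have infT : has_inf T by split; [exists pi|exists 0].
pose t0 := inf T.
have t0_ge0 : 0 <= t0 by apply: lb_le_inf; [exists pi|].
have Clt r : 0 <= r < t0 -> C (geod x v r).
  move=> /andP[r0 rt]; apply: contrapT => nC.
  have : t0 <= r by apply: ge_inf; [exists 0|].
  by lra.
have nC : ~ C (geod x v t0).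
  move=> Ct0.
  have : nbhs t0 [set t | C (geod x v t)].
    apply: (@geod_continuous R n x v t0); apply: open_nbhs_nbhs; split => //.
    exact: open_cone_over.
  move=> /nbhs_ballP[e /= e0 be].
  have [r Tr rt] := inf_adherent e0 infT; rewrite -/t0 in rt.
  have t0r : t0 <= r by apply: ge_inf; [exists 0|].
  by case: Tr => _; apply; apply: be; rewrite /ball /= ltr_norml; lra.
have t0_gt0 : 0 < t0.
  rewrite lt_neqAle t0_ge0 andbT; apply/eqP => t00; apply: nC.
  by rewrite -t00 geod0; exact: subset_cone_over.
have cl : closure C (geod x v t0).
  move=> B nB; have /nbhs_ballP[e /= e0 be] := @geod_continuous R n x v t0 _ nB.
  (* The maximum with 0 keeps r within the range where the geodesic is in C. *)
  pose r := Num.max 0 (t0 - e / 2).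
  have [r0 rt] : 0 <= r /\ r < t0 by rewrite /r le_max gt_max lexx t0_gt0; lra.
  have re : t0 - e / 2 <= r by rewrite /r le_max lexx orbT.
  exists (geod x v r); split; first by apply: Clt; rewrite r0.
  by apply: be; rewrite /ball /= ltr_norml; lra.
exists t0; last by [].
rewrite t0_ge0 lt_neqAle ge_inf ?andbT //=; last by exists 0.
apply/eqP => t0pi; have := closure_cone_over_last_ge0 _ cl.
by rewrite t0pi geodpi mxE; lra.
Qed.

(** With s, t the distances from x to y and to b, the coefficients are sin s,
sin t and sin (t - s). They are positive because y precedes b (the arc from x to
y is inside the open set) and b precedes - x. *)
Lemma sph_b_spec x y : Omega x -> Omega y -> x <> y ->
  let b := sph_b Omega x y in
  exists s a c : R, [/\ 0 < s, 0 < a, 0 < c & s *: b = a *: y - c *: x] /\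
    [/\ closure C b, ~ C b &
      sin (sph_dist x b) / sin (sph_dist y b) = a / c].
Proof.
move=> Ox Oy xy b.
have [x1 _] := upper _ Ox.
have geodS v t : unit_tangent x v -> usphere (geod x v t).
  by move=> xv; rewrite /usphere /= /enorm dotv_geod// subrr cos0 sqrtr1.
have : sph_first_hit Omega x y b.
  rewrite /b /sph_b; apply: xgetPex.
  have [v [s [xv sp ys Os]]] := geod_arc _ _ Ox Oy xy.
  have [t /andP[t0 tpi] [clt nCt Ct]] := first_exit _ v Ox.
  exists (geod x v t), v, t; split => //.
  - by split => //; exists s.
  - by apply/boundary_usphere; split => //; exact: geodS.
  - by move=> r rt /boundary_usphere[_ _]; apply; exact: Ct.
move=> [v [t [[xv [s sp ys]] t0 bt /boundary_usphere[_ clb nCb] nb]]].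
have /andP[s0 spi] := sp.
have tpi : t < pi.
  have [r /andP[r0 rpi] [clr nCr _]] := first_exit _ v Ox.
  rewrite ltNge; apply/negP => pit; apply: (nb r); first by rewrite r0; lra.
  by apply/boundary_usphere; split => //; exact: geodS.
have sins := sin_gt0_pi sp.
have st : s < t.
  rewrite ltNge; apply/negP => ts; apply: nCb; rewrite -bt.
  have [->|t_neq0] := eqVneq t 0; first by rewrite geod0; exact: subset_cone_over.
  have [->|t_neqs] := eqVneq t s; first by rewrite ys; exact: subset_cone_over.
  have tgt0 : 0 < t by rewrite lt_neqAle eq_sym t_neq0.
  have tlts : t < s by rewrite lt_neqAle t_neqs.
  rewrite -(scalerK (lt0r_neq0 sins) (geod x v t)) geod_interpol ys.
  apply: cone_overZ; first by rewrite invr_gt0.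
  by apply: cone_over_comb => //; apply: sin_gt0_pi; lra.
exists (sin s), (sin t), (sin (t - s)); split; split => //.
- by apply: sin_gt0_pi; lra.
- by apply: sin_gt0_pi; lra.
- by rewrite -bt geod_interpol ys -opprB sinN scaleNr addrC.
- rewrite -bt -[X in sph_dist X _](geod0 x v) -ys !sin_sph_dist_geod ?subr0//; lra.
Qed.

(** * Comparison of the Funk metrics *)

Local Notation P := (@central_proj R n).

Lemma cone_over_central_proj x : Omega x -> C (P x).
Proof.
move=> Ox; have [_ /= xl] := upper _ Ox.
by apply: cone_overZ; [rewrite invr_gt0|exact: subset_cone_over].
Qed.

Lemma last_central_proj x : Omega x -> last (P x) = 1.
Proof.
by move=> Ox; have [_ /= xl] := upper _ Ox; rewrite lastZ mulVf// gt_eqF.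
Qed.

Lemma central_projK x : Omega x -> last x *: P x = x.
Proof.
move=> Ox; have [_ /= xl] := upper _ Ox.
by rewrite /central_proj scalerA mulfV ?scale1r// gt_eqF.
Qed.

Lemma central_proj_inj x y : Omega x -> Omega y -> P x = P y -> x = y.
Proof.
move=> Ox Oy; have [x1 /= xl] := upper _ Ox; have [y1 /= yl] := upper _ Oy.
have : enorm (P x) = (last x)^-1.
  by rewrite enormZ x1 mulr1 gtr0_norm// invr_gt0.
have : enorm (P y) = (last y)^-1.
  by rewrite enormZ y1 mulr1 gtr0_norm// invr_gt0.
move=> + + xy; rewrite -xy => -> /invr_inj l.
by rewrite -(central_projK _ Ox) -(central_projK _ Oy) xy l.
Qed.

(** By convexity the ray is inside the domain up to time 1, so that all hits
occur beyond the second point. *)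
Lemma euc_hitP x y p : Omega x -> Omega y ->
  euc_hit (P @` Omega) (P x) (P y) p <->
  exists2 t : R, 1 < t & [/\ p = P x + t *: (P y - P x), closure C p & ~ C p].
Proof.
move=> Ox Oy; split=> [[[t t0 pt] /boundary_hyperplane1[_ clp nCp]]|].
  exists t => //; rewrite ltNge; apply/negP => t1; apply: nCp; rewrite pt.
  have -> : P x + t *: (P y - P x) = (1 - t) *: P x + t *: P y.
    by rewrite scalerBr scalerBl scale1r addrA addrAC.
  have [->|tn0] := eqVneq t 0.
    by rewrite subr0 scale1r scale0r addr0; exact: cone_over_central_proj.
  have [->|tn1] := eqVneq t 1.
    by rewrite subrr scale1r scale0r add0r; exact: cone_over_central_proj.
  have tgt0 : 0 < t by rewrite lt_neqAle eq_sym tn0.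
  have tlt1 : t < 1 by rewrite lt_neqAle tn1.
  apply: cone_overD; apply: cone_overZ; rewrite ?subr_gt0//;
    exact: cone_over_central_proj.
move=> [t t1 [pt clp nCp]]; split; first by exists t => //; lra.
apply/boundary_hyperplane1; split => //.
by rewrite /hyperplane1 /= pt !mxE -!lastZ !last_central_proj//; ring.
Qed.

(** The Funk distance differs from the logarithm of the spherical ratio a / c by a
coboundary in the last coordinates. The formula also holds when the Euclidean ray
never leaves the domain: then b is on the equator and the argument of ln is 1. *)
Lemma euc_funkE x y (s a c : R) b : Omega x -> Omega y -> x <> y ->
  0 < s -> 0 < a -> 0 < c -> s *: b = a *: y - c *: x ->
  closure C b -> ~ C b ->
  euc_funk (P @` Omega) (P x) (P y) = ln (a / c * (last y / last x)).
Proof.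
move=> Ox Oy xy s0 a0 c0 sb clb nCb.
have [_ /= xl] := upper _ Ox; have [_ /= yl] := upper _ Oy.
(* Coefficients of the exit point in terms of P x and P y. *)
pose A := a * last y; pose B := c * last x.
have A0 : 0 < A by rewrite mulr_gt0.
have B0 : 0 < B by rewrite mulr_gt0.
have -> : a / c * (last y / last x) = A / B.
  by rewrite /A /B; field; rewrite !gt_eqF.
have sbE : s *: b = A *: P y - B *: P x.
  by rewrite sb /A /B -!scalerA !central_projK.
have clAB : closure C (A *: P y - B *: P x).
  by rewrite -sbE; exact: closure_coneZ cone_overZ _ _ _ _.
have nCAB : ~ C (A *: P y - B *: P x).
  rewrite -sbE => /(cone_overZ s^-1); rewrite scalerK ?gt_eqF// invr_gt0.
  by move=> /(_ s0).
have BA : B <= A.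
  have := closure_cone_over_last_ge0 _ clAB.
  by rewrite mxE [X in _ + X]mxE (lastZ A) (lastZ B) !last_central_proj// !mulr1 subr_ge0.
have lineE (t : R) : P x + t *: (P y - P x) = t *: P y - (t - 1) *: P x.
  by rewrite scalerBr scalerBl scale1r opprB addrCA.
rewrite /euc_funk; case: asboolP => [[Pxy hit]|nhit].
  have : euc_hit (P @` Omega) (P x) (P y) (euc_b (P @` Omega) (P x) (P y)).
    exact: xgetPex.
  move: (euc_b _ _ _) => p /euc_hitP[]// t t1 [pt clp nCp].
  (* The hit and the spherical exit point lie in the same boundary direction. *)
  have tr : A * (t - 1) = t * B.
    apply: (@exit_ratio _ _ C open_cone_over cone_overZ cone_overD (P x) (P y)) => //.
    - exact: cone_over_central_proj.
    - by rewrite subr_gt0.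
    - by rewrite -lineE -pt.
    - by rewrite -lineE -pt.
  have -> : P x - p = (- t) *: (P y - P x).
    by rewrite pt opprD addrA subrr add0r scaleNr.
  have -> : P y - p = (1 - t) *: (P y - P x).
    by rewrite pt opprD addrA scalerBl scale1r.
  have N0 : enorm (P y - P x) != 0.
    by apply/eqP => /enorm_eq0/subr0_eq/esym.
  rewrite !enormZ normrN gtr0_norm ?ltr0_norm; [|lra|lra].
  congr ln; rewrite invfM mulrACA divff// mulr1.
  have t1' : 0 < - (1 - t) by lra.
  by apply/eqP; rewrite (eqr_div _ _ (lt0r_neq0 t1') (lt0r_neq0 B0)) -tr opprB.
(* Without a hit, A > B is impossible, since the ray would leave at
   (A v - B u) / (A - B). *)
have [->|nAB] := eqVneq A B; first by rewrite divff ?ln1// gt_eqF.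
have AB : 0 < A - B by rewrite subr_gt0 lt_neqAle eq_sym nAB.
exfalso; apply: nhit; split.
  by move=> /(central_proj_inj _ _ Ox Oy).
exists ((A - B)^-1 *: (A *: P y - B *: P x)); apply/euc_hitP => //.
exists (A / (A - B)); first by rewrite ltr_pdivlMr//; lra.
split.
- rewrite lineE scalerBr; congr (_ - _); rewrite scalerA; congr (_ *: _).
    by rewrite mulrC.
  by field; rewrite gt_eqF.
- by apply: closure_coneZ => //; [exact: cone_overZ|rewrite invr_gt0].
- move=> /(cone_overZ (A - B)); rewrite scalerKV ?gt_eqF//.
  by move=> /(_ AB).
Qed.

Lemma euc_hilbert_central_proj x y : Omega x -> Omega y ->
  euc_hilbert (P @` Omega) (P x) (P y) = sph_hilbert Omega x y.
Proof.
move=> Ox Oy; rewrite /euc_hilbert /sph_hilbert.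
have [<-|/eqP xy] := eqVneq x y.
  by rewrite /euc_funk asboolF ?addr0 ?mulr0//; case.
have yx : y <> x by move=> /esym.
have [_ /= xl] := upper _ Ox; have [_ /= yl] := upper _ Oy.
have [s [a [c [[s0 a0 c0 sb] [clb nCb acE]]]]] := sph_b_spec _ _ Ox Oy xy.
have [s' [a' [c' [[s'0 a'0 c'0 sb'] [clb' nCb' acE']]]]] := sph_b_spec _ _ Oy Ox yx.
rewrite (euc_funkE _ _ _ _ _ _ Ox Oy xy s0 a0 c0 sb)//.
rewrite (euc_funkE _ _ _ _ _ _ Oy Ox yx s'0 a'0 c'0 sb')//.
rewrite acE acE' -lnM ?posrE ?mulr_gt0 ?invr_gt0//.
by congr (_ * ln _); field; rewrite !gt_eqF.
Qed.

End ConeOver.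

Theorem corollary4p9 (R : realType) (n : nat) (Omega : set 'rV[R]_n.+1)
    (Omega_neq0 : Omega !=set0)
    (Omega_upper : Omega `<=` @upper_hemisphere R n)
    (Omega_open : open_in (@usphere R n) Omega)
    (Omega_convex : sph_convex Omega) :
  let Omega' := @central_proj R n @` Omega in
  [/\ open_in (@hyperplane1 R n) Omega',
      convex_set (Omega' : set (convex_lmodType 'rV[R]_n.+1)) &
      isometry_on Omega (sph_hilbert Omega) Omega' (euc_hilbert Omega')
        (@central_proj R n)].
Proof.
move=> Omega'.
have Omega'E : cone_over Omega `&` @hyperplane1 R n = Omega'.
  exact: cone_over_hyperplane1.
split.
- rewrite -Omega'E; have oC := open_cone_over _ Omega_upper Omega_open.
  exact: (@open_in_slice _ _ _ oC (fun z : 'rV[R]_n.+1 => z ord0 ord_max)).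
- apply/convex_setW => x y; rewrite !inE -Omega'E => -[Cx x1] [Cy y1] k k0 k1.
  rewrite inE; split.
    apply: cone_overD => //; apply: cone_overZ => //.
    by rewrite subr_gt0.
  rewrite /hyperplane1 /= !mxE; rewrite x1 y1 !mulr1.
  exact: unstable.add_onemK.
- split; last by move=> x y Ox Oy; exact: euc_hilbert_central_proj.
  split=> [x Ox|x y|y [x Ox <-]]; first by exists x.
  - rewrite !inE; exact: central_proj_inj.
  - by exists x.
Qed.
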